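(* Let $\mathbf C=(\mathbf C,\otimes)$ and $\mathbf D=(\mathbf D,\odot)$ be symmetric (strict) monoidal categories closed relative to full subcategories $\mathbf P\subset\mathbf C$ and $\mathbf Q\subset\mathbf D$ respectively. Let $F=(F,\varphi,\phi)\colon(\mathbf C,\otimes)\to(\mathbf D,\odot)$ be a lax monoidal functor satisfying $F(\mathbf P)\subset\mathbf Q$, let $\mathbb M=(X,\mu_X,\eta_X)$ be a monoid in $\mathbf C$, and let $\widetilde{\mathbb M}=\mathrm{Mon}(F)\mathbb M$ be the monoid in $\mathbf D$ given by $FX$ with multiplication $F\mu_X\cdot\phi_{X,X}$ and unit $F\eta_X\cdot\varphi$. Then $F$ induces a functor $$F_{\mathbf P,\mathbb M}\colon\mathrm{Rep}_{\mathbf P}(\mathbb M)\to\mathrm{Rep}_{\mathbf Q}(\widetilde{\mathbb M}),$$ which maps $(V,\rho)$ to $(FV,\widetilde\rho)$, where $\widetilde\rho\colon\widetilde{\mathbb M}\to\mathbf{end}(FV)$ is the composition $$FX\xrightarrow{F\rho}F\big(\mathbf{end}(V)\big)\xrightarrow{\Phi_{V,V}}\mathbf{end}(FV),$$ and which maps a morphism $f\colon(V,\rho)\to(W,\tau)$ to $Ff\colon(FV,\widetilde\rho)\to(FW,\widetilde\tau)$, where $\widetilde\tau=\Phi_{W,W}\cdot F\tau$.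
   Context: Monoidal categories are strict; $f\cdot g$ denotes composition ($g$ first). A symmetric monoidal category $(\mathbf C,\otimes,I)$ is closed relative to a full subcategory $\mathbf P$ if there are a bifunctor $\mathbf{hom}\colon\mathbf P^{op}\times\mathbf P\to\mathbf C$ and bijections $\theta_{X,V,W}\colon\mathrm{Hom}(X,\mathbf{hom}(V,W))\to\mathrm{Hom}(X\otimes V,W)$ natural in $X\in\mathbf C$, $V,W\in\mathbf P$. Put $\mathrm{ev}_{V,W}=\theta(\mathrm{id})\colon\mathbf{hom}(V,W)\otimes V\to W$. For $V\in\mathbf P$, $\mathbf{end}(V)=\mathbf{hom}(V,V)$ is a monoid with multiplication $c_V=\theta^{-1}\big(\mathrm{ev}_{V,V}\cdot(\mathrm{id}\otimes\mathrm{ev}_{V,V})\big)$ and unit $u_V=\theta^{-1}(\mathrm{id}_V)$. The same notation is used in $\mathbf D$. $\mathrm{Rep}_{\mathbf P}(\mathbb M)$: objects are pairs $(V,\rho)$ with $V\in\mathbf P$ and $\rho\colon\mathbb M\to\mathbf{end}(V)$ a morphism of monoids; morphisms $(V,\rho)\to(W,\tau)$ are morphisms $f\colon V\to W$ in $\mathbf P$ with $\mathbf{hom}(\mathrm{id}_V,f)\cdot\rho=\mathbf{hom}(f,\mathrm{id}_W)\cdot\tau$. The lax structure is $\varphi\colon I_{\mathbf D}\to FI_{\mathbf C}$ and $\phi_{X,Y}\colon FX\odot FY\to F(X\otimes Y)$. For $V,W\in\mathbf P$, $\Phi_{V,W}=\theta^{-1}\big(F(\mathrm{ev}_{V,W})\cdot\phi_{\mathbf{hom}(V,W),V}\big)\colon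 F\big(\mathbf{hom}(V,W)\big)\to\mathbf{hom}(FV,FW)$. *)

(* Defs.v *)
From Stdlib Require Import ssreflect ssrfun ProofIrrelevance.

Set Implicit Arguments.
Unset Strict Implicit.
Unset Printing Implicit Defensive.

Declare Scope cat_scope.
Delimit Scope cat_scope with cat.
Open Scope cat_scope.

Record Category := {
  Ob :> Type;
  Hom : Ob -> Ob -> Type;
  idm : forall X, Hom X X;
  comp : forall X Y Z, Hom Y Z -> Hom X Y -> Hom X Z;
  comp1m : forall X Y (f : Hom X Y), comp (idm Y) f = f;
  compm1 : forall X Y (f : Hom X Y), comp f (idm X) = f;
  compmA : forall X Y Z W (h : Hom Z W) (g : Hom Y Z) (f : Hom X Y),
    comp h (comp g f) = comp (comp h g) f }.

Arguments Hom {_} X Y.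
Arguments idm {_} X.
Arguments comp {_ X Y Z} g f.

Notation "g · f" := (comp g f) (at level 40, left associativity) : cat_scope.

(* The identity seen as a morphism between equal objects.  The equality of
   objects needed to state strictness is propositional, so it acts on morphisms
   only through these casts. *)
Definition idto (C : Category) (X Y : C) (e : X = Y) : Hom X Y :=
  match e in _ = Z return Hom X Z with eq_refl => idm X end.

Lemma idto_irr (C : Category) (X Y : C) (e e' : X = Y) : idto e = idto e'.
Proof. by rewrite (proof_irrelevance _ e e'). Qed.

Lemma idto_comp (C : Category) (X Y Z : C) (e' : Y = Z) (e : X = Y) :
  idto e' · idto e = idto (eq_trans e e').
Proof. by case: _ / e'; rewrite comp1m. Qed.

Record FunctorData (C D : Category) := {
  fob :> C -> D;
  fmap : forall X Y : C, Hom X Y -> Hom (fob X) (fob Y) }.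

Arguments fmap {C D} _ {X Y} f.

Record Functor (C D : Category) := {
  fdata :> FunctorData C D;
  fmap1 : forall X : C, fmap fdata (idm X) = idm (fdata X);
  fmapM : forall (X Y Z : C) (g : Hom Y Z) (f : Hom X Y),
    fmap fdata (g · f) = fmap fdata g · fmap fdata f }.

Definition op_cat (C : Category) : Category.
Proof.
refine {| Ob := Ob C; Hom := fun X Y : C => Hom Y X; idm := fun X => idm X;
          comp := fun X Y Z g f => f · g |}.
- by move=> X Y f; apply: compm1.
- by move=> X Y f; apply: comp1m.
- by move=> X Y Z W h g f; rewrite compmA.
Defined.

Definition prod_cat (C D : Category) : Category.
Proof.
refine {| Ob := (Ob C * Ob D)%type;
          Hom := fun X Y => (Hom X.1 Y.1 * Hom X.2 Y.2)%type;
          idm := fun X => (idm X.1, idm X.2);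
          comp := fun X Y Z g f => (g.1 · f.1, g.2 · f.2) |}.
- by move=> X Y [f1 f2]; rewrite !comp1m.
- by move=> X Y [f1 f2]; rewrite !compm1.
- by move=> X Y Z W h g f; rewrite /= !compmA.
Defined.

Definition full_sub (C : Category) (P : C -> Prop) : Category.
Proof.
refine {| Ob := {X : C | P X};
          Hom := fun V W => Hom (sval V) (sval W);
          idm := fun V => idm (sval V);
          comp := fun V W U g f => g · f |}.
- by move=> V W f; apply: comp1m.
- by move=> V W f; apply: compm1.
- by move=> V W U T h g f; apply: compmA.
Defined.

(* Bifunctors, with the two arguments separated. *)
Definition biob (A B C : Category) (T : Functor (prod_cat A B) C)
  (X : A) (Y : B) : C := T (X, Y).

Definition bimap (A B C : Category) (T : Functor (prod_cat A B) C)
  (X X' : A) (Y Y' : B) (f : Hom X X') (g : Hom Y Y') :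
  Hom (biob T X Y) (biob T X' Y') :=
  @fmap _ _ T (X, Y) (X', Y') (f, g).

Lemma bimap1 (A B C : Category) (T : Functor (prod_cat A B) C)
  (X : A) (Y : B) : bimap T (idm X) (idm Y) = idm (biob T X Y).
Proof. exact: (fmap1 T (X, Y)). Qed.

Lemma bimapM (A B C : Category) (T : Functor (prod_cat A B) C)
  (X X' X'' : A) (Y Y' Y'' : B) (f' : Hom X' X'') (f : Hom X X')
  (g' : Hom Y' Y'') (g : Hom Y Y') :
  bimap T (f' · f) (g' · g) = bimap T f' g' · bimap T f g.
Proof.
exact: (@fmapM _ _ T (X, Y) (X', Y') (X'', Y'') (f', g') (f, g)).
Qed.

(* Strict monoidal categories: associativity and unit laws hold as equalities of
   objects and, up to the resulting casts, of morphisms.  The pentagon and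
   triangle need not be required: all their sides are casts of identities, and
   parallel casts agree by [idto_irr]. *)
Record StrictMonoidal := {
  mcat :> Category;
  tensor : Functor (prod_cat mcat mcat) mcat;
  munit : mcat;
  tensorA : forall X Y Z : mcat,
    biob tensor (biob tensor X Y) Z = biob tensor X (biob tensor Y Z);
  tensor1X : forall X : mcat, biob tensor munit X = X;
  tensorX1 : forall X : mcat, biob tensor X munit = X;
  tensorA_nat : forall (X X' Y Y' Z Z' : mcat)
      (f : Hom X X') (g : Hom Y Y') (h : Hom Z Z'),
    idto (tensorA X' Y' Z') · bimap tensor (bimap tensor f g) h
    = bimap tensor f (bimap tensor g h) · idto (tensorA X Y Z);
  tensor1X_nat : forall (X X' : mcat) (f : Hom X X'),
    idto (tensor1X X') · bimap tensor (idm munit) f = f · idto (tensor1X X);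
  tensorX1_nat : forall (X X' : mcat) (f : Hom X X'),
    idto (tensorX1 X') · bimap tensor f (idm munit) = f · idto (tensorX1 X) }.

Arguments munit {_}.

Notation "X ⊗ Y" := (biob (tensor _) X Y)
  (at level 38, right associativity) : cat_scope.
Notation "f ⊗' g" := (bimap (tensor _) f g)
  (at level 38, right associativity) : cat_scope.

Definition assoc (C : StrictMonoidal) (X Y Z : C) :
  Hom ((X ⊗ Y) ⊗ Z) (X ⊗ (Y ⊗ Z)) := idto (tensorA X Y Z).
Definition lunit (C : StrictMonoidal) (X : C) : Hom (munit ⊗ X) X :=
  idto (tensor1X X).
Definition runit (C : StrictMonoidal) (X : C) : Hom (X ⊗ munit) X :=
  idto (tensorX1 X).

Record SymMonoidal := {
  smcat :> StrictMonoidal;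
  braid : forall X Y : smcat, Hom (X ⊗ Y) (Y ⊗ X);
  braid_nat : forall (X X' Y Y' : smcat) (f : Hom X X') (g : Hom Y Y'),
    braid X' Y' · (f ⊗' g) = (g ⊗' f) · braid X Y;
  braidK : forall X Y : smcat, braid Y X · braid X Y = idm (X ⊗ Y);
  braid_unit : forall X : smcat, lunit X · braid X munit = runit X;
  braid_hexagon : forall X Y Z : smcat,
    assoc Y Z X · braid X (Y ⊗ Z) · assoc X Y Z
    = (idm Y ⊗' braid X Z) · assoc Y X Z · (braid X Y ⊗' idm Z) }.

(* Closedness relative to the full subcategory with objects [P]. *)
Record RelClosed (C : SymMonoidal) (P : C -> Prop) := {
  ihom : Functor (prod_cat (op_cat (full_sub P)) (full_sub P)) C;
  theta : forall (X : C) (V W : full_sub P),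
    Hom X (biob ihom V W) -> Hom (X ⊗ sval V) (sval W);
  theta_inv : forall (X : C) (V W : full_sub P),
    Hom (X ⊗ sval V) (sval W) -> Hom X (biob ihom V W);
  thetaK : forall (X : C) (V W : full_sub P) (a : Hom X (biob ihom V W)),
    theta_inv (theta a) = a;
  theta_invK : forall (X : C) (V W : full_sub P)
      (b : Hom (X ⊗ sval V) (sval W)),
    theta (theta_inv b) = b;
  theta_nat : forall (X X' : C) (V V' W W' : full_sub P)
      (x : Hom X' X) (v : Hom V' V) (w : Hom W W') (a : Hom X (biob ihom V W)),
    theta (@bimap _ _ _ ihom V V' W W' v w · a · x)
    = (w : Hom (sval W) (sval W')) · theta a
      · (x ⊗' (v : Hom (sval V') (sval V))) }.

Arguments theta {C P} K {X V W} a : rename.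
Arguments theta_inv {C P} K {X V W} b : rename.

(* [hommap K v w] is hom(v, w) : hom(V, W) -> hom(V', W'), contravariant in the
   first argument. *)
Definition hommap (C : SymMonoidal) (P : C -> Prop) (K : RelClosed P)
  (V V' W W' : full_sub P) (v : Hom V' V) (w : Hom W W') :
  Hom (biob (ihom K) V W) (biob (ihom K) V' W') :=
  @bimap _ _ _ (ihom K) V V' W W' v w.

Definition ev (C : SymMonoidal) (P : C -> Prop) (K : RelClosed P)
  (V W : full_sub P) : Hom (biob (ihom K) V W ⊗ sval V) (sval W) :=
  theta K (idm (biob (ihom K) V W)).

Record MonoidIn (C : StrictMonoidal) := {
  mcar : C;
  mmul : Hom (mcar ⊗ mcar) mcar;
  mone : Hom munit mcar;
  mmulA : mmul · (mmul ⊗' idm mcar)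
          = mmul · (idm mcar ⊗' mmul) · assoc mcar mcar mcar;
  mmul1m : mmul · (mone ⊗' idm mcar) = lunit mcar;
  mmulm1 : mmul · (idm mcar ⊗' mone) = runit mcar }.

Definition is_monoid_mor (C : StrictMonoidal) (M N : MonoidIn C)
  (f : Hom (mcar M) (mcar N)) : Prop :=
  f · mmul M = mmul N · (f ⊗' f) /\ f · mone M = mone N.

Lemma bimap_idtol (C : StrictMonoidal) (X X' Y : C) (e : X = X') :
  idto e ⊗' idm Y = idto (f_equal (fun Z => Z ⊗ Y) e).
Proof. by case: _ / e; apply: bimap1. Qed.

Lemma bimap_idtor (C : StrictMonoidal) (X Y Y' : C) (e : Y = Y') :
  idm X ⊗' idto e = idto (f_equal (fun Z => X ⊗ Z) e).
Proof. by case: _ / e; apply: bimap1. Qed.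

Lemma bimap_compl (C : StrictMonoidal) (X X' X'' Y : C) (f : Hom X' X'')
  (g : Hom X X') : (f · g) ⊗' idm Y = (f ⊗' idm Y) · (g ⊗' idm Y).
Proof. by rewrite -bimapM comp1m. Qed.

Lemma bimap_compr (C : StrictMonoidal) (X Y Y' Y'' : C) (f : Hom Y' Y'')
  (g : Hom Y Y') : idm X ⊗' (f · g) = (idm X ⊗' f) · (idm X ⊗' g).
Proof. by rewrite -bimapM comp1m. Qed.

Lemma bimap_lr (C : StrictMonoidal) (X X' Y Y' : C) (f : Hom X X')
  (g : Hom Y Y') : f ⊗' g = (f ⊗' idm Y') · (idm X ⊗' g).
Proof. by rewrite -bimapM comp1m compm1. Qed.

Lemma bimap_rl (C : StrictMonoidal) (X X' Y Y' : C) (f : Hom X X')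
  (g : Hom Y Y') : f ⊗' g = (idm X' ⊗' g) · (f ⊗' idm Y).
Proof. by rewrite -bimapM comp1m compm1. Qed.

Lemma assoc_nat (C : StrictMonoidal) (X X' Y Y' Z Z' : C)
  (f : Hom X X') (g : Hom Y Y') (h : Hom Z Z') :
  assoc X' Y' Z' · ((f ⊗' g) ⊗' h) = (f ⊗' (g ⊗' h)) · assoc X Y Z.
Proof. exact: tensorA_nat. Qed.

Lemma lunit_nat (C : StrictMonoidal) (X X' : C) (f : Hom X X') :
  lunit X' · (idm munit ⊗' f) = f · lunit X.
Proof. exact: tensor1X_nat. Qed.

Lemma runit_nat (C : StrictMonoidal) (X X' : C) (f : Hom X X') :
  runit X' · (f ⊗' idm munit) = f · runit X.
Proof. exact: tensorX1_nat. Qed.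

Lemma pentagon (C : StrictMonoidal) (X Y Z W : C) :
  (idm X ⊗' assoc Y Z W) · assoc X (Y ⊗ Z) W · (assoc X Y Z ⊗' idm W)
  = assoc X Y (Z ⊗ W) · assoc (X ⊗ Y) Z W.
Proof.
rewrite /assoc bimap_idtol bimap_idtor !idto_comp; exact: idto_irr.
Qed.

Lemma triangle (C : StrictMonoidal) (X Y : C) :
  (idm X ⊗' lunit Y) · assoc X munit Y = runit X ⊗' idm Y.
Proof.
rewrite /assoc /lunit /runit bimap_idtol bimap_idtor !idto_comp.
exact: idto_irr.
Qed.

Lemma lunit_tensor (C : StrictMonoidal) (X Y : C) :
  lunit (X ⊗ Y) · assoc munit X Y = lunit X ⊗' idm Y.
Proof.
rewrite /assoc /lunit bimap_idtol !idto_comp; exact: idto_irr.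
Qed.

Lemma theta_natl (C : SymMonoidal) (P : C -> Prop) (K : RelClosed P)
  (X X' : C) (V W : full_sub P) (a : Hom X (biob (ihom K) V W)) (x : Hom X' X) :
  theta K (a · x) = theta K a · (x ⊗' idm (sval V)).
Proof.
have := theta_nat (r := K) x (idm V) (idm W) a.
rewrite bimap1 comp1m => ->.
by congr (_ · _); apply: comp1m.
Qed.

Lemma theta_inj (C : SymMonoidal) (P : C -> Prop) (K : RelClosed P)
  (X : C) (V W : full_sub P) (a b : Hom X (biob (ihom K) V W)) :
  theta K a = theta K b -> a = b.
Proof. by move=> e; rewrite -(thetaK a) e thetaK. Qed.

Lemma theta_ev (C : SymMonoidal) (P : C -> Prop) (K : RelClosed P)
  (X : C) (V W : full_sub P) (a : Hom X (biob (ihom K) V W)) :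
  theta K a = ev K V W · (a ⊗' idm (sval V)).
Proof. by rewrite -theta_natl comp1m. Qed.

Definition end_ob (C : SymMonoidal) (P : C -> Prop) (K : RelClosed P)
  (V : full_sub P) : C := biob (ihom K) V V.

(* The casts [assoc] and [lunit] stand for the strict identifications of
   (end(V) ⊗ end(V)) ⊗ V with end(V) ⊗ (end(V) ⊗ V) and of I ⊗ V with V. *)
Definition end_mul (C : SymMonoidal) (P : C -> Prop) (K : RelClosed P)
  (V : full_sub P) : Hom (end_ob K V ⊗ end_ob K V) (end_ob K V) :=
  theta_inv K (ev K V V · (idm (end_ob K V) ⊗' ev K V V)
               · assoc (end_ob K V) (end_ob K V) (sval V)).

Definition end_one (C : SymMonoidal) (P : C -> Prop) (K : RelClosed P)
  (V : full_sub P) : Hom munit (end_ob K V) :=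
  theta_inv K (V := V) (W := V) (lunit (sval V)).

Lemma ev_end_mul (C : SymMonoidal) (P : C -> Prop) (K : RelClosed P)
  (V : full_sub P) :
  ev K V V · (end_mul K V ⊗' idm (sval V))
  = ev K V V · (idm (end_ob K V) ⊗' ev K V V)
    · assoc (end_ob K V) (end_ob K V) (sval V).
Proof. by rewrite -theta_ev theta_invK. Qed.

Lemma ev_end_one (C : SymMonoidal) (P : C -> Prop) (K : RelClosed P)
  (V : full_sub P) :
  ev K V V · (end_one K V ⊗' idm (sval V)) = lunit (sval V).
Proof. by rewrite -theta_ev theta_invK. Qed.

Lemma ev_end_mul_comp (C : SymMonoidal) (P : C -> Prop) (K : RelClosed P)
  (V : full_sub P) (X Y : C) (f : Hom X (end_ob K V)) (g : Hom Y (end_ob K V)) :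
  ev K V V · ((end_mul K V · (f ⊗' g)) ⊗' idm (sval V))
  = ev K V V · (f ⊗' (ev K V V · (g ⊗' idm (sval V)))) · assoc X Y (sval V).
Proof.
rewrite bimap_compl compmA ev_end_mul -compmA assoc_nat compmA.
by congr (_ · _); rewrite -compmA -bimapM comp1m.
Qed.

Lemma end_mulA (C : SymMonoidal) (P : C -> Prop) (K : RelClosed P)
  (V : full_sub P) :
  end_mul K V · (end_mul K V ⊗' idm (end_ob K V))
  = end_mul K V · (idm (end_ob K V) ⊗' end_mul K V)
    · assoc (end_ob K V) (end_ob K V) (end_ob K V).
Proof.
apply: theta_inj; rewrite !theta_ev ev_end_mul_comp bimap1 compm1.
rewrite bimap_compl compmA ev_end_mul_comp ev_end_mul.
rewrite [end_mul K V ⊗' ev K V V]bimap_lr !compmA ev_end_mul.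
rewrite -[idm (end_ob K V ⊗ end_ob K V)]bimap1 -!compmA.
congr (_ · _); rewrite [assoc _ _ _ · (_ · _)]compmA assoc_nat.
rewrite !bimap_compr -!compmA; congr (_ · _); congr (_ · _).
by rewrite -pentagon compmA.
Qed.

Lemma end_mul1m (C : SymMonoidal) (P : C -> Prop) (K : RelClosed P)
  (V : full_sub P) :
  end_mul K V · (end_one K V ⊗' idm (end_ob K V)) = lunit (end_ob K V).
Proof.
apply: theta_inj; rewrite !theta_ev ev_end_mul_comp bimap1 compm1.
rewrite bimap_lr compmA ev_end_one lunit_nat -compmA.
by rewrite lunit_tensor.
Qed.

Lemma end_mulm1 (C : SymMonoidal) (P : C -> Prop) (K : RelClosed P)
  (V : full_sub P) :
  end_mul K V · (idm (end_ob K V) ⊗' end_one K V) = runit (end_ob K V).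
Proof.
apply: theta_inj; rewrite !theta_ev ev_end_mul_comp ev_end_one.
by rewrite -compmA triangle.
Qed.

Definition end_monoid (C : SymMonoidal) (P : C -> Prop) (K : RelClosed P)
  (V : full_sub P) : MonoidIn C :=
  {| mcar := end_ob K V; mmul := end_mul K V; mone := end_one K V;
     mmulA := end_mulA K V; mmul1m := end_mul1m K V;
     mmulm1 := end_mulm1 K V |}.

Record LaxMonoidal (C D : StrictMonoidal) := {
  lfun :> Functor C D;
  lax_unit : Hom munit (lfun munit);
  lax_mul : forall X Y : C, Hom (lfun X ⊗ lfun Y) (lfun (X ⊗ Y));
  lax_mul_nat : forall (X X' Y Y' : C) (f : Hom X X') (g : Hom Y Y'),
    lax_mul X' Y' · (fmap lfun f ⊗' fmap lfun g)
    = fmap lfun (f ⊗' g) · lax_mul X Y;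
  lax_mulA : forall X Y Z : C,
    fmap lfun (assoc X Y Z) · lax_mul (X ⊗ Y) Z
      · (lax_mul X Y ⊗' idm (lfun Z))
    = lax_mul X (Y ⊗ Z) · (idm (lfun X) ⊗' lax_mul Y Z)
      · assoc (lfun X) (lfun Y) (lfun Z);
  lax_mul1X : forall X : C,
    fmap lfun (lunit X) · lax_mul munit X · (lax_unit ⊗' idm (lfun X))
    = lunit (lfun X);
  lax_mulX1 : forall X : C,
    fmap lfun (runit X) · lax_mul X munit · (idm (lfun X) ⊗' lax_unit)
    = runit (lfun X) }.

Arguments lax_unit {C D} _.
Arguments lax_mul {C D} _ X Y.

Definition mon_map (C D : StrictMonoidal) (F : LaxMonoidal C D)
  (M : MonoidIn C) : MonoidIn D.
Proof.
refine {| mcar := F (mcar M);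
          mmul := fmap F (mmul M) · lax_mul F (mcar M) (mcar M);
          mone := fmap F (mone M) · lax_unit F |}.
- rewrite bimap_compl bimap_compr -[in LHS]fmap1 -[in RHS]fmap1.
  rewrite -[LHS]compmA [lax_mul F _ _ · (_ · _)]compmA lax_mul_nat.
  rewrite -[RHS]compmA -[RHS]compmA -[in RHS](compmA (fmap F (idm _) ⊗' _)).
  rewrite [in RHS](compmA (lax_mul F _ _)) lax_mul_nat !compmA -!fmapM mmulA.
  rewrite !fmapM -!compmA; congr (_ · _); congr (_ · _).
  by rewrite !compmA fmap1; apply: lax_mulA.
- rewrite bimap_compl -[in LHS]fmap1.
  rewrite -[LHS]compmA [lax_mul F _ _ · (_ · _)]compmA lax_mul_nat.
  by rewrite !compmA -!fmapM mmul1m fmap1 lax_mul1X.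
- rewrite bimap_compr -[in LHS]fmap1.
  rewrite -[LHS]compmA [lax_mul F _ _ · (_ · _)]compmA lax_mul_nat.
  by rewrite !compmA -!fmapM mmulm1 fmap1 lax_mulX1.
Defined.

Record RepOb (C : SymMonoidal) (P : C -> Prop) (K : RelClosed P)
    (M : MonoidIn C) := mkRepOb {
  rep_ob : full_sub P;
  rep_act : Hom (mcar M) (end_ob K rep_ob);
  rep_actP : is_monoid_mor (N := end_monoid K rep_ob) rep_act }.

Definition is_rep_mor (C : SymMonoidal) (P : C -> Prop) (K : RelClosed P)
  (M : MonoidIn C) (A B : RepOb K M) (f : Hom (rep_ob A) (rep_ob B)) : Prop :=
  hommap K (idm (rep_ob A)) f · rep_act A
  = hommap K f (idm (rep_ob B)) · rep_act B.

Lemma hommap_comp (C : SymMonoidal) (P : C -> Prop) (K : RelClosed P)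
  (V V' V'' W W' W'' : full_sub P) (v' : Hom V'' V') (v : Hom V' V)
  (w' : Hom W' W'') (w : Hom W W') :
  hommap K (v · v') (w' · w) = hommap K v' w' · hommap K v w.
Proof.
exact: (@bimapM _ _ _ (ihom K) V V' V'' W W' W'' v' v w' w).
Qed.

Lemma is_rep_mor_comp (C : SymMonoidal) (P : C -> Prop) (K : RelClosed P)
  (M : MonoidIn C) (A B D : RepOb K M)
  (g : Hom (rep_ob B) (rep_ob D)) (f : Hom (rep_ob A) (rep_ob B)) :
  is_rep_mor g -> is_rep_mor f -> is_rep_mor (A := A) (B := D) (g · f).
Proof.
rewrite /is_rep_mor => eg ef.
rewrite -{1}(comp1m (idm (rep_ob A))) -{1}(comp1m (idm (rep_ob D))).
rewrite !hommap_comp -!compmA ef -eg !compmA -!hommap_comp.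
by rewrite !(comp1m, compm1).
Qed.

Definition Rep (C : SymMonoidal) (P : C -> Prop) (K : RelClosed P)
  (M : MonoidIn C) : Category.
Proof.
refine {| Ob := RepOb K M;
          Hom := fun A B => {f : Hom (rep_ob A) (rep_ob B) | is_rep_mor f};
          idm := fun A => exist _ (idm (rep_ob A)) (eq_refl _);
          comp := fun A B D g f =>
            exist _ (sval g · sval f) (is_rep_mor_comp (svalP g) (svalP f)) |}.
- by move=> A B f; apply: eq_sig_hprop => [? | /=];
    [exact: proof_irrelevance | rewrite comp1m].
- by move=> A B f; apply: eq_sig_hprop => [? | /=];
    [exact: proof_irrelevance | rewrite compm1].
- by move=> A B D E h g f; apply: eq_sig_hprop => [? | /=];
    [exact: proof_irrelevance | rewrite compmA].
Defined.

(* The object part of the restriction of [F] to P -> Q. *)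
Definition sub_ob (C D : Category) (F : Functor C D) (P : C -> Prop)
  (Q : D -> Prop) (FPQ : forall V : C, P V -> Q (F V)) (V : full_sub P) :
  full_sub Q := exist Q (F (sval V)) (FPQ (sval V) (svalP V)).

Definition Phi (C D : SymMonoidal) (P : C -> Prop) (Q : D -> Prop)
  (K : RelClosed P) (L : RelClosed Q) (F : LaxMonoidal C D)
  (FPQ : forall V : C, P V -> Q (F V)) (V W : full_sub P) :
  Hom (F (biob (ihom K) V W))
      (biob (ihom L) (sub_ob FPQ V) (sub_ob FPQ W)) :=
  theta_inv L (V := sub_ob FPQ V) (W := sub_ob FPQ W)
    (fmap F (ev K V W) · lax_mul F (biob (ihom K) V W) (sval V)).

Definition induced_act (C D : SymMonoidal) (P : C -> Prop) (Q : D -> Prop)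
  (K : RelClosed P) (L : RelClosed Q) (F : LaxMonoidal C D)
  (FPQ : forall V : C, P V -> Q (F V)) (M : MonoidIn C) (A : RepOb K M) :
  Hom (mcar (mon_map F M)) (end_ob L (sub_ob FPQ (rep_ob A))) :=
  Phi K L FPQ (rep_ob A) (rep_ob A) · fmap F (rep_act A).

(* Main.v *)
Require Import Defs.
From Stdlib Require Import ssreflect ssrfun ProofIrrelevance.

(** By the adjunction [theta], a map [rho : X -> end(V)] is the same thing as a
    map [r : X ⊗ V -> V].  Under this correspondence [rho] is a morphism of
    monoids exactly when [r] satisfies the associativity and unit laws of an
    action ([monoid_mor_action]), and a map [f : V -> W] is a morphism of
    representations exactly when it is equivariant ([rep_mor_equivariant]).

    The map [Phi] is made so that the transpose of [Phi · F a] is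
    [F (theta a) · phi] ([theta_Phi]).  Hence the induced [rho~] corresponds to
    [F r · phi : FX ⊗ FV -> FV], and the theorem reduces to two facts about a
    lax monoidal functor: it carries actions to actions, by naturality of
    [phi] together with its associativity and unit coherence
    ([lax_action_mul], [lax_action_one]), and equivariant maps to equivariant
    maps, by naturality of [phi].  Functoriality is inherited from that of [F],
    the equivariance condition being a proposition. *)

Set Implicit Arguments.
Unset Strict Implicit.
Unset Printing Implicit Defensive.

Local Open Scope cat_scope.

Lemma theta_hommap (C : SymMonoidal) (P : C -> Prop) (K : RelClosed P)
  (X : C) (V V' W W' : full_sub P) (v : Hom V' V) (w : Hom W W')
  (a : Hom X (biob (ihom K) V W)) :
  theta K (hommap K v w · a)
  = (w : Hom (sval W) (sval W')) · theta K a
    · (idm X ⊗' (v : Hom (sval V') (sval V))).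
Proof.
rewrite -theta_nat; congr (theta _ _).
by rewrite compm1.
Qed.

Lemma theta_end_mul (C : SymMonoidal) (P : C -> Prop) (K : RelClosed P)
  (V : full_sub P) (X : C) (a : Hom X (end_ob K V)) :
  theta K (end_mul K V · (a ⊗' a))
  = theta K a · (idm X ⊗' theta K a) · assoc X X (sval V).
Proof.
by rewrite theta_ev ev_end_mul_comp -theta_ev bimap_lr compmA -theta_ev.
Qed.

(** A map into [end(V)] is a morphism of monoids iff its transpose is an action
    of the monoid on [V]. *)
Lemma monoid_mor_action (C : SymMonoidal) (P : C -> Prop) (K : RelClosed P)
  (M : MonoidIn C) (V : full_sub P) (a : Hom (mcar M) (end_ob K V)) :
  is_monoid_mor (N := end_monoid K V) a <->
  theta K a · (mmul M ⊗' idm (sval V))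
    = theta K a · (idm (mcar M) ⊗' theta K a)
      · assoc (mcar M) (mcar M) (sval V)
  /\ theta K a · (mone M ⊗' idm (sval V)) = lunit (sval V).
Proof.
rewrite -!theta_natl -theta_end_mul -(theta_invK K (lunit (sval V))).
split=> [[eM e1]|[eM e1]].
- by split; congr (theta _ _).
- by split; apply: (theta_inj (K := K)).
Qed.

(** Morphisms of representations are the maps that are equivariant for the
    transposed actions. *)
Lemma rep_mor_equivariant (C : SymMonoidal) (P : C -> Prop) (K : RelClosed P)
  (M : MonoidIn C) (A B : RepOb K M) (f : Hom (rep_ob A) (rep_ob B)) :
  is_rep_mor f <->
  (f : Hom (sval (rep_ob A)) (sval (rep_ob B))) · theta K (rep_act A)
  = theta K (rep_act B)
    · (idm (mcar M) ⊗' (f : Hom (sval (rep_ob A)) (sval (rep_ob B)))).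
Proof.
have eA : theta K (hommap K (idm (rep_ob A)) f · rep_act A)
    = (f : Hom (sval (rep_ob A)) (sval (rep_ob B))) · theta K (rep_act A).
  by rewrite theta_hommap [X in _ · X]bimap1 compm1.
have eB : theta K (hommap K f (idm (rep_ob B)) · rep_act B)
    = theta K (rep_act B)
      · (idm (mcar M) ⊗' (f : Hom (sval (rep_ob A)) (sval (rep_ob B)))).
  by rewrite theta_hommap [X in X · _]comp1m.
rewrite -eA -eB; split=> [e|]; last exact: theta_inj.
by congr (theta _ _).
Qed.

Lemma lax_mul_natl (C D : StrictMonoidal) (F : LaxMonoidal C D)
  (X X' Y : C) (f : Hom X X') :
  lax_mul F X' Y · (fmap F f ⊗' idm (F Y))
  = fmap F (f ⊗' idm Y) · lax_mul F X Y.
Proof. by rewrite -(fmap1 F Y) lax_mul_nat. Qed.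

Lemma lax_mul_natr (C D : StrictMonoidal) (F : LaxMonoidal C D)
  (X Y Y' : C) (g : Hom Y Y') :
  lax_mul F X Y' · (idm (F X) ⊗' fmap F g)
  = fmap F (idm X ⊗' g) · lax_mul F X Y.
Proof. by rewrite -(fmap1 F X) lax_mul_nat. Qed.

Lemma lax_action_mul (C D : StrictMonoidal) (F : LaxMonoidal C D)
  (X V : C) (m : Hom (X ⊗ X) X) (r : Hom (X ⊗ V) V) :
  r · (m ⊗' idm V) = r · (idm X ⊗' r) · assoc X X V ->
  fmap F r · lax_mul F X V · ((fmap F m · lax_mul F X X) ⊗' idm (F V))
  = fmap F r · lax_mul F X V · (idm (F X) ⊗' (fmap F r · lax_mul F X V))
    · assoc (F X) (F X) (F V).
Proof.
move=> er; rewrite bimap_compl bimap_compr.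
transitivity (fmap F (r · (m ⊗' idm V)) · lax_mul F (X ⊗ X) V
              · (lax_mul F X X ⊗' idm (F V))).
  by rewrite fmapM compmA -(compmA (fmap F r)) lax_mul_natl !compmA.
rewrite er !fmapM -!compmA; congr (_ · _).
(* Naturality moves [F r] past [phi]; the rest is associativity of [phi]. *)
rewrite [in RHS](compmA (lax_mul F X V)) lax_mul_natr -!compmA.
by congr (_ · _); rewrite !compmA; apply: lax_mulA.
Qed.

Lemma lax_action_one (C D : StrictMonoidal) (F : LaxMonoidal C D)
  (X V : C) (e : Hom munit X) (r : Hom (X ⊗ V) V) :
  r · (e ⊗' idm V) = lunit V ->
  fmap F r · lax_mul F X V · ((fmap F e · lax_unit F) ⊗' idm (F V))
  = lunit (F V).
Proof.
move=> er; rewrite bimap_compl compmA -(compmA (fmap F r)) lax_mul_natl.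
by rewrite compmA -fmapM er lax_mul1X.
Qed.

(** The defining property of [Phi]: it implements on transposes the passage
    from [X ⊗ V -> W] to [FX ⊗ FV -> FW] given by [F] and [phi]. *)
Lemma theta_Phi (C D : SymMonoidal) (P : C -> Prop) (Q : D -> Prop)
  (K : RelClosed P) (L : RelClosed Q) (F : LaxMonoidal C D)
  (FPQ : forall V : C, P V -> Q (F V)) (X : C) (V W : full_sub P)
  (a : Hom X (biob (ihom K) V W)) :
  theta L (Phi K L FPQ V W · fmap F a)
  = fmap F (theta K a) · lax_mul F X (sval V).
Proof.
rewrite theta_natl /Phi theta_invK -compmA [X in _ · X]lax_mul_natl.
by rewrite compmA -fmapM -theta_ev.
Qed.

Lemma induced_act_monoid_mor (C D : SymMonoidal) (P : C -> Prop) (Q : D -> Prop)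
  (K : RelClosed P) (L : RelClosed Q) (F : LaxMonoidal C D)
  (FPQ : forall V : C, P V -> Q (F V)) (M : MonoidIn C) (A : RepOb K M) :
  is_monoid_mor (M := mon_map F M)
    (N := end_monoid L (sub_ob FPQ (rep_ob A))) (induced_act L FPQ A).
Proof.
have [eM e1] := proj1 (monoid_mor_action _) (rep_actP A).
apply/monoid_mor_action; rewrite /induced_act theta_Phi; split.
- exact: lax_action_mul.
- exact: lax_action_one.
Qed.

Lemma fmap_rep_mor (C D : SymMonoidal) (P : C -> Prop) (Q : D -> Prop)
  (K : RelClosed P) (L : RelClosed Q) (F : LaxMonoidal C D)
  (FPQ : forall V : C, P V -> Q (F V)) (M : MonoidIn C) (A B : RepOb K M)
  (f : Hom (rep_ob A) (rep_ob B)) :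
  is_rep_mor f ->
  is_rep_mor (A := mkRepOb (induced_act_monoid_mor L FPQ A))
    (B := mkRepOb (induced_act_monoid_mor L FPQ B)) (fmap F f).
Proof.
move=> /rep_mor_equivariant ef; apply/rep_mor_equivariant.
rewrite /= /induced_act !theta_Phi compmA -fmapM ef fmapM -!compmA.
by congr (_ · _); rewrite -lax_mul_natr.
Qed.

Theorem theorem3p27 (C D : SymMonoidal) (P : C -> Prop) (Q : D -> Prop)
    (K : RelClosed P) (L : RelClosed Q) (F : LaxMonoidal C D)
    (FPQ : forall V : C, P V -> Q (F V)) (M : MonoidIn C) :
  exists (actP : forall A : RepOb K M,
            is_monoid_mor (M := mon_map F M)
              (N := end_monoid L (sub_ob FPQ (rep_ob A)))
              (induced_act L FPQ A))
         (morP : forall (A B : RepOb K M) (f : Hom (rep_ob A) (rep_ob B)),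
            is_rep_mor f ->
            is_rep_mor (A := mkRepOb (actP A)) (B := mkRepOb (actP B))
              (fmap F f))
         (FPM : Functor (Rep K M) (Rep L (mon_map F M))),
    fdata FPM =
    {| fob := fun A : Rep K M => mkRepOb (actP A) : Rep L (mon_map F M);
       fmap := fun (A B : Rep K M) (f : Hom A B) =>
         exist _ (fmap F (proj1_sig f)) (morP A B (proj1_sig f) (proj2_sig f)) |}.
Proof.
exists (@induced_act_monoid_mor _ _ _ _ K L F FPQ M).
exists (@fmap_rep_mor _ _ _ _ K L F FPQ M).
pose FD : FunctorData (Rep K M) (Rep L (mon_map F M)) :=
  {| fob := fun A : Rep K M =>
       mkRepOb (induced_act_monoid_mor L FPQ A) : Rep L (mon_map F M);
     fmap := fun (A B : Rep K M) (f : Hom A B) =>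
       exist _ (fmap F (sval f)) (fmap_rep_mor L FPQ (proj2_sig f)) |}.
have FD1 (A : Rep K M) : fmap FD (idm A) = idm (FD A).
  by apply: eq_sig_hprop => [? | /=]; [exact: proof_irrelevance | exact: fmap1].
have FDM (A B E : Rep K M) (g : Hom B E) (f : Hom A B) :
    fmap FD (g · f) = fmap FD g · fmap FD f.
  by apply: eq_sig_hprop => [? | /=]; [exact: proof_irrelevance | exact: fmapM].
by exists {| fdata := FD; fmap1 := FD1; fmapM := FDM |}.
Qed.
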